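(* Let $X$ be a real reflexive separable Banach space and let $F \subset X$ be a non-empty, closed, bounded and convex existence set with non-empty interior in $X$. Then $F$ is the intersection of a countable family of contractive half-spaces.
   Context: For a non-empty set $F \subset X$ and $x \in X$, let $R_F(x) = \{ d \in F : \|d-c\| \le \|x-c\| \text{ for all } c \in F\}$; $F$ is an existence set if $R_F(x) \neq \emptyset$ for every $x \in X$. A non-empty set $D \subset X$ is contractive if there exists $P : X \to D$ with $P|_D = \mathrm{id}_D$ and $\|Px - Py\| \le \|x-y\|$ for all $x,y \in X$. A half-space is a set $\{x \in X : f(x) \le d\}$ with $f \in X^* \setminus\{0\}$ and $d \in \mathbb{R}$; a contractive half-space is a half-space which is a contractive set. *)

(* Defs.v *)
From HB Require Import structures.
From mathcomp Require Import all_boot all_order all_algebra.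
From mathcomp Require Import all_classical all_reals all_analysis.
Set Implicit Arguments. Unset Strict Implicit. Unset Printing Implicit Defensive.
Import Order.TTheory GRing.Theory Num.Theory.
Import numFieldNormedType.Exports.
Local Open Scope classical_set_scope.
Local Open Scope ring_scope.

Section Defs.
Variables (R : realType) (X : normedModType R).

Definition dual_elem (f : X -> R) : Prop :=
  continuous f /\ forall (a : R) (x y : X), f (a *: x + y) = a * f x + f y.

(* phi : X^* -> R is a bounded linear functional on X^* (an element of X^** ),
   boundedness w.r.t. the dual norm ||f|| = inf {M >= 0 | |f x| <= M ||x||} *)
Definition bidual_elem (phi : (X -> R) -> R) : Prop :=
  (forall f g, dual_elem f -> dual_elem g -> phi (f \+ g) = phi f + phi g) /\
  (forall (a : R) f, dual_elem f -> phi (fun x => a * f x) = a * phi f) /\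
  (exists C : R, forall f (M : R), dual_elem f -> 0 <= M ->
      (forall x, `|f x| <= M * `|x|) -> `|phi f| <= C * M).

Definition reflexive_space : Prop :=
  forall phi, bidual_elem phi -> exists x : X, forall f, dual_elem f -> phi f = f x.

Definition separable_space : Prop :=
  exists D : set X, countable D /\ closure D = setT.

Definition bounded_subset (F : set X) : Prop :=
  exists M : R, forall x, F x -> `|x| <= M.

Definition convex_subset (F : set X) : Prop :=
  forall x y (t : R), F x -> F y -> 0 <= t -> t <= 1 -> F (t *: x + (1 - t) *: y).

Definition RF (F : set X) (x : X) : set X :=
  [set d | F d /\ forall c, F c -> `|d - c| <= `|x - c|].

Definition existence_set (F : set X) : Prop :=
  F !=set0 /\ forall x, RF F x !=set0.

Definition contractive (D : set X) : Prop :=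
  D !=set0 /\ exists P : X -> X,
    (forall x, D (P x)) /\ (forall x, D x -> P x = x) /\
    (forall x y, `|P x - P y| <= `|x - y|).

Definition half_space (H : set X) : Prop :=
  exists (f : X -> R) (d : R), dual_elem f /\ (exists x, f x != 0) /\
    H = [set x | f x <= d].

Definition contractive_half_space (H : set X) : Prop :=
  half_space H /\ contractive H.

End Defs.

(* Main.v *)
(* Let p be the gauge of F centred at an interior point.  By Mazur's theorem p is
   Gateaux differentiable at a dense set of points s, and a subgradient f of p at
   such an s supports F; countably many of these half-spaces already cut out F.
   At the smooth boundary point c0 = s / p s the blow-ups n (F - c0) exhaust the
   open half-space {f < 0}, so rescaled points of R_F converge weakly to some x
   with f x <= 0 and |x - c| <= |c0 - c| whenever f c <= 0.  This gives w with
   f w = 1 and |u| <= |u + w| on ker f: projecting along w is a norm-one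
   projection onto ker f, and pushing points along w is a nonexpansive retraction
   onto each half-space {f <= d}. *)

Require Import Defs.
From HB Require Import structures.
From mathcomp Require Import all_boot all_order all_algebra.
From mathcomp Require Import all_classical all_reals all_analysis.
From mathcomp Require Import ring lra.
Set Implicit Arguments.
Unset Strict Implicit.
Unset Printing Implicit Defensive.
Import Order.TTheory GRing.Theory Num.Theory.
Import numFieldNormedType.Exports.
Local Open Scope classical_set_scope.
Local Open Scope ring_scope.

(** * Sublinear functions and the Hahn-Banach theorem *)

Lemma inf_le_infD (R : realType) (B C : set R) (a : R) :
  B !=set0 -> C !=set0 -> (forall b c, B b -> C c -> a <= b + c) ->
  a <= inf B + inf C.
Proof.
move=> B0 C0 aBC; rewrite -lerBlDl; apply: lb_le_inf => // c Cc.
rewrite lerBlDl -lerBlDr; apply: lb_le_inf => // b Bb.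
by rewrite lerBlDr aBC.
Qed.

(** Homogeneity is asked only as an inequality for positive factors, which passes easily to infima;
    applying it to the inverse factor gives equality. *)
Definition sublinear (R : realType) (V : lmodType R) (p : V -> R) : Prop :=
  (forall x y, p (x + y) <= p x + p y) /\
  (forall (a : R) x, 0 < a -> p (a *: x) <= a * p x).

Lemma sublinear0 (R : realType) (V : lmodType R) (p : V -> R) :
  sublinear p -> p 0 = 0.
Proof.
move=> [pD pZ]; have := pD 0 0; have := pZ 2^-1 0; rewrite addr0 scaler0.
have h : (0 : R) < 2^-1 by lra.
move=> /(_ h); lra.
Qed.

Lemma sublinearZ (R : realType) (V : lmodType R) (p : V -> R) (a : R) x :
  sublinear p -> 0 <= a -> p (a *: x) = a * p x.
Proof.
move=> sp; rewrite le_eqVlt => /predU1P[<-|a0].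
  by rewrite scale0r mul0r sublinear0.
apply/le_anti/andP; split; first exact: sp.2.
have := sp.2 a^-1 (a *: x); rewrite invr_gt0 => /(_ a0).
by rewrite scalerK ?gt_eqF// ler_pdivlMl.
Qed.

Lemma sublinear_ge_opp (R : realType) (V : lmodType R) (p : V -> R) x :
  sublinear p -> - p (- x) <= p x.
Proof.
move=> sp; have := sp.1 x (- x); rewrite subrr sublinear0//; lra.
Qed.

(** For [t > 0] and [h = 1 / t] these are the difference quotients [(p (z + h x) - p z) / h], so for
    sublinear [p] their infimum is the one-sided derivative of [p] at [z] in direction [x]. *)
Definition slopes (R : realType) (V : lmodType R) (p : V -> R) (z x : V) : set R :=
  [set r | exists2 t : R, 0 <= t & r = p (x + t *: z) - t * p z].

Lemma slopes_lbound (R : realType) (V : lmodType R) (p : V -> R) z x :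
  sublinear p -> lbound (slopes p z x) (- p (- x)).
Proof.
move=> sp _ [t t0 ->]; have := sp.1 (x + t *: z) (- x).
rewrite addrAC subrr add0r sublinearZ//; lra.
Qed.

Lemma inf_slopes_le (R : realType) (V : lmodType R) (p : V -> R) z x (t : R) :
  sublinear p -> 0 <= t -> inf (slopes p z x) <= p (x + t *: z) - t * p z.
Proof.
move=> sp t0; apply: ge_inf; last by exists t.
by exists (- p (- x)); exact: slopes_lbound.
Qed.

Lemma slopes_nonempty (R : realType) (V : lmodType R) (p : V -> R) z x :
  slopes p z x !=set0.
Proof. by exists (p (x + 0 *: z) - 0 * p z), 0. Qed.

Lemma inf_slopes_le_id (R : realType) (V : lmodType R) (p : V -> R) z x :
  sublinear p -> inf (slopes p z x) <= p x.
Proof.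
by move=> sp; have := inf_slopes_le z x sp (lexx 0); rewrite scale0r mul0r addr0 subr0.
Qed.

Lemma inf_slopes_sublinear (R : realType) (V : lmodType R) (p : V -> R) z :
  sublinear p -> sublinear (fun x => inf (slopes p z x)).
Proof.
move=> sp; split=> [x y|a x a0].
  apply: inf_le_infD; try exact: slopes_nonempty.
  move=> _ _ [s s0 ->] [t t0 ->].
  apply: le_trans (inf_slopes_le z (x + y) sp (addr_ge0 s0 t0)) _.
  by rewrite scalerDl addrACA; have := sp.1 (x + s *: z) (y + t *: z); lra.
rewrite -ler_pdivrMl//; apply: lb_le_inf; first exact: slopes_nonempty.
move=> _ [t t0 ->]; rewrite ler_pdivrMl//.
apply: le_trans (inf_slopes_le z _ sp (mulr_ge0 (ltW a0) t0)) _.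
by rewrite -scalerA -scalerDr (sublinearZ _ sp (ltW a0)) mulrBr mulrA.
Qed.

(** The directional derivative of [q] at [y] is a sublinear minorant of [q]. Minimality puts it
    above [q], and its slope at [t = 1] then gives [q x <= q (x + y) - q y]. *)
Lemma minimal_sublinear_linear (R : realType) (V : lmodType R) (q : V -> R) :
  sublinear q ->
  (forall r, sublinear r -> (forall x, r x <= q x) -> forall x, q x <= r x) ->
  forall (a : R) x y, q (a *: x + y) = a * q x + q y.
Proof.
move=> sq qmin.
have qD x y : q (x + y) = q x + q y.
  apply/le_anti/andP; split; first exact: sq.1.
  have := qmin _ (inf_slopes_sublinear y sq) (fun x => inf_slopes_le_id y x sq) x.
  have := inf_slopes_le y x sq ler01; rewrite scale1r; lra.
have qN x : q (- x) = - q x.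
  by apply/eqP; rewrite -addr_eq0 -qD addNr sublinear0.
move=> a x y; rewrite qD; congr (_ + _).
have [a0|a0] := leP 0 a; first exact: sublinearZ.
rewrite -[a]opprK scaleNr qN (sublinearZ _ sq) ?oppr_ge0; [by rewrite !mulNr|exact: ltW].
Qed.

(** Zorn's lemma for the reversed pointwise order: a non-empty chain is bounded by its pointwise
    infimum, which is finite because each member is at least [- p (- x)] at [x]. *)
Lemma exists_minimal_sublinear (R : realType) (V : lmodType R) (p : V -> R) :
  sublinear p -> exists q, [/\ sublinear q, forall x, q x <= p x &
    forall r, sublinear r -> (forall x, r x <= q x) -> forall x, q x <= r x].
Proof.
move=> sp; pose T := {q : V -> R | sublinear q /\ forall x, q x <= p x}.
pose ord (s t : T) := `[< forall x, sval t x <= sval s x >].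
have T0 : T by exists p; split.
have [||A Atot|[q [sq qp]] qmax] := @ZL_preorder T T0 ord.
- by move=> t; apply/asboolP.
- move=> r s t /asboolP rs /asboolP st; apply/asboolP => x.
  exact: le_trans (st x) (rs x).
- have [[s0 As0]|A0] := pselect (A !=set0); last first.
    by exists T0 => s As; case: A0; exists s.
  pose E x := [set r | exists2 s, A s & r = sval s x].
  have E0 x : E x !=set0 by exists (sval s0 x), s0.
  have Elb x : lbound (E x) (- p (- x)).
    move=> _ [[s [ss sle]] As ->] /=.
    by apply: le_trans (sublinear_ge_opp x ss); rewrite lerN2.
  have infE s x : A s -> inf (E x) <= sval s x.
    by move=> As; apply: ge_inf; [exists (- p (- x))|exists s].
  have sinf : sublinear (fun x => inf (E x)).
    split=> [x y|b x b0].
      apply: inf_le_infD => // _ _ [s As ->] [t At ->].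
      (* The values at [x] and [y] may come from different members of the chain; the smaller member
         serves at both points. *)
      have [st|ts] := Atot s t As At.
        apply: le_trans (infE t _ At) _; apply: le_trans ((svalP t).1.1 _ _) _.
        by rewrite lerD2r; move/asboolP: st; exact.
      apply: le_trans (infE s _ As) _; apply: le_trans ((svalP s).1.1 _ _) _.
      by rewrite lerD2l; move/asboolP: ts; exact.
    rewrite -ler_pdivrMl//; apply: lb_le_inf => // _ [s As ->].
    rewrite ler_pdivrMl//; apply: le_trans (infE s _ As) _.
    exact: (svalP s).1.2.
  have infp x : inf (E x) <= p x.
    exact: le_trans (infE s0 _ As0) ((svalP s0).2 x).
  exists (exist _ (fun x => inf (E x)) (conj sinf infp)) => s As.
  by apply/asboolP => x; exact: infE.
exists q; split=> // r sr rq.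
have rp x : r x <= p x by exact: le_trans (qp x).
by apply/asboolP; apply: (qmax (exist _ r (conj sr rp))); exact/asboolP.
Qed.

(* Minimal sublinear functions are linear; minimising below [inf (slopes p z _)],
   whose value at [- z] is at most [- p z], forces the value at [z]. *)
Lemma hahn_banach (R : realType) (V : lmodType R) (p : V -> R) (z : V) :
  sublinear p -> exists f : V -> R,
    [/\ forall (a : R) x y, f (a *: x + y) = a * f x + f y,
        forall x, f x <= p x & f z = p z].
Proof.
move=> sp.
have [f [sf fle fmin]] := exists_minimal_sublinear (inf_slopes_sublinear z sp).
have flin := minimal_sublinear_linear sf fmin.
have fp x : f x <= p x by apply: le_trans (fle x) (inf_slopes_le_id z x sp).
exists f; split => //; apply/le_anti; rewrite fp /=.
have := le_trans (fle (- z)) (inf_slopes_le z (- z) sp ler01).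
rewrite scale1r addNr sublinear0//.
have := flin (-1) z 0; rewrite scaleN1r addr0 sublinear0//; lra.
Qed.

(** * Smooth points of sublinear functions *)

Lemma open_normP (R : realType) (X : normedModType R) (A : set X) :
  open A <-> forall x, A x -> exists2 e : R, 0 < e &
    forall y, `|x - y| < e -> A y.
Proof.
rewrite openE; split=> H x /H.
  by move=> /nbhs_ballP[e e0]; rewrite -ball_normE => xA; exists e.
by move=> [e e0 xA]; apply/nbhs_ballP; exists e => //; rewrite -ball_normE.
Qed.

Lemma lip_continuous (R : realType) (X : normedModType R) (f : X -> R) (L : R) :
  0 <= L -> (forall x y, f x - f y <= L * `|x - y|) -> continuous f.
Proof.
move=> L0 fL; apply/continuousP => A /open_normP Ao; apply/open_normP => x /Ao.
move=> [e e0 xA]; have L1 : 0 < L + 1 by lra.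
exists (e / (L + 1)); first by rewrite divr_gt0.
move=> y; rewrite ltr_pdivlMr// => xy; apply: xA.
have := fL x y; have := fL y x; rewrite [`|y - x|]distrC ltr_norml.
have := normr_ge0 (x - y); nra.
Qed.

Lemma sublinear_lip (R : realType) (X : normedModType R) (p : X -> R) (L : R) x y :
  sublinear p -> (forall x, p x <= L * `|x|) -> p x - p y <= L * `|x - y|.
Proof.
move=> sp pL; have := pL (x - y); have := sp.1 (x - y) y.
by rewrite subrK; lra.
Qed.

Lemma linear_sub (R : realType) (X : lmodType R) (f : X -> R) x y :
  (forall (a : R) x y, f (a *: x + y) = a * f x + f y) -> f (x - y) = f x - f y.
Proof.
by move=> fl; rewrite addrC -scaleN1r fl mulN1r addrC.
Qed.

Lemma dual_elem_bounded (R : realType) (X : normedModType R) (f : X -> R) (L : R) :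
  0 <= L -> (forall (a : R) x y, f (a *: x + y) = a * f x + f y) ->
  (forall x, f x <= L * `|x|) -> dual_elem f.
Proof.
move=> L0 fl fL; split=> //; apply: (lip_continuous L0) => x y.
by rewrite -linear_sub.
Qed.

(** For sublinear [p] the quotient [(p (x + t v) + p (x - t v) - 2 p x) / t] decreases, as [t] tends
    to 0, to the sum of the one-sided derivatives along [v] and [- v]. Membership for every
    [eta > 0] thus means differentiability along [v]. *)
Definition symmetric_slope_lt (R : realType) (X : lmodType R) (p : X -> R)
    (v : X) (eta : R) : set X :=
  [set x | exists2 t : R, 0 < t & p (x + t *: v) + p (x - t *: v) < 2 * p x + t * eta].

Lemma open_symmetric_slope_lt (R : realType) (X : normedModType R) (p : X -> R)
    (L : R) (v : X) (eta : R) :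
  0 <= L -> sublinear p -> (forall x, p x <= L * `|x|) ->
  open (symmetric_slope_lt p v eta).
Proof.
move=> L0 sp pL; apply/open_normP => x [t t0 xt].
(* [d] is the slack at [x] for this [t]. Moving to [y] costs at most [4 * L * |x - y|]: once for
   each shifted point and twice for [2 * p x]. *)
set d := 2 * p x + t * eta - (p (x + t *: v) + p (x - t *: v)).
have L1 : 0 < 4 * L + 1 by lra.
exists (d / (4 * L + 1)); first by rewrite divr_gt0// /d; lra.
move=> y; rewrite ltr_pdivlMr// => xy; exists t => //.
have := sublinear_lip x y sp pL.
have := sublinear_lip (y + t *: v) (x + t *: v) sp pL.
have := sublinear_lip (y - t *: v) (x - t *: v) sp pL.
have shift z : y + z - (x + z) = y - x by rewrite opprD addrACA subrr addr0.
rewrite !shift [`|y - x|]distrC.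
have := normr_ge0 (x - y); rewrite /d in xy; nra.
Qed.

(* If every point of a segment had symmetric slope at least [eta], the slope of
   [p] along the segment would grow linearly in the number of subdivision steps,
   against the Lipschitz bound. *)
Lemma dense_symmetric_slope_lt (R : realType) (X : normedModType R) (p : X -> R)
    (L : R) (v : X) (eta : R) :
  0 <= L -> sublinear p -> (forall x, p x <= L * `|x|) -> 0 < eta ->
  dense (symmetric_slope_lt p v eta).
Proof.
move=> L0 sp pL eta0 O [x Ox] /open_normP /(_ x Ox)[e e0 xO].
apply: contrapT => nO.
have steep z t : O z -> 0 < t ->
    2 * p z + t * eta <= p (z + t *: v) + p (z - t *: v).
  move=> Oz t0; rewrite leNgt; apply/negP => zt.
  by apply: nO; exists z; split => //; exists t.
have v1 : 0 < `|v| + 1 by have := normr_ge0 v; lra.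
pose d := e / (`|v| + 1).
have d0 : 0 < d by rewrite divr_gt0.
have dv : d * `|v| < e.
  by rewrite /d mulrAC ltr_pdivrMr// mulrDr mulr1; lra.
(* Two increments of [p] over steps [t *: v] differ by at most [2 * L * t * |v|]; [N] gains of
   [t * eta] exceed this. *)
pose N := (Num.trunc (2 * L * `|v| / eta)).+1.
have Neta : 2 * L * `|v| < N%:R * eta.
  by rewrite -ltr_pdivrMr//; exact: truncnS_gt.
pose t := d / N%:R.
have N0 : (0 : R) < N%:R by rewrite ltr0n.
have t0 : 0 < t by rewrite divr_gt0.
(* Each interior subdivision point, still in [O], raises the increment of [p] by at least
   [t * eta]. *)
have grow k : (k <= N)%N -> p (x + t *: v) - p x + k%:R * (t * eta) <=
    p (x + (k.+1%:R * t) *: v) - p (x + (k%:R * t) *: v).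
  elim: k => [_|k IH kN]; first by rewrite !mul0r scale0r !addr0 mul1r.
  have Oz : O (x + (k.+1%:R * t) *: v).
    apply: xO; rewrite opprD addNKr normrN normrZ ger0_norm; last first.
      by rewrite mulr_ge0// ltW.
    apply: le_lt_trans dv; rewrite ler_wpM2r// /t mulrA ler_pdivrMr//.
    by rewrite mulrC ler_pM2l// ler_nat.
  have := IH (ltnW kN); have := steep _ _ Oz t0.
  rewrite -!addrA -scalerDl -scalerBl.
  have -> : k.+1%:R * t + t = k.+2%:R * t by rewrite -(natr1 k.+1); ring.
  have -> : k.+1%:R * t - t = k%:R * t by rewrite -natr1; ring.
  by rewrite -[in k.+1%:R * (t * eta)]natr1 mulrDl mul1r; lra.
have := grow N (leqnn _).
have := sublinear_lip (x + (N.+1%:R * t) *: v) (x + (N%:R * t) *: v) sp pL.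
have := sublinear_lip x (x + t *: v) sp pL.
have -> : x + (N.+1%:R * t) *: v - (x + (N%:R * t) *: v) = t *: v.
  by rewrite opprD addrACA subrr add0r -scalerBl -mulrBl -natr1 addrAC subrr add0r mul1r.
rewrite opprD addNKr normrN normrZ (gtr0_norm t0).
have : t * (2 * L * `|v|) < t * (N%:R * eta) by rewrite ltr_pM2l.
lra.
Qed.

Lemma separable_sequence (R : realType) (X : normedModType R) :
  separable_space X -> exists e : nat -> X,
    forall x (d : R), 0 < d -> exists n, `|x - e n| < d.
Proof.
move=> [D [cD Dd]]; have /pfcard_geP[D0|[e]] := cD.
  have : closure D 0 by rewrite Dd.
  by rewrite D0 closure0.
exists e => x d d0; have : closure D x by rewrite Dd.
move=> /(_ (ball x d) (nbhsx_ballx x d d0))[y [Dy]]; rewrite -ball_normE /= => xy.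
by have [n _ en] := @surj _ _ _ _ e y Dy; exists n; rewrite en.
Qed.

(* Mazur's theorem: a continuous sublinear function on a separable Banach space
   is Gateaux differentiable on a dense set, differentiability being expressed by
   vanishing symmetric slopes. *)
Lemma dense_smooth_points (R : realType) (X : completeNormedModType R) (p : X -> R)
    (L : R) :
  separable_space X -> 0 <= L -> sublinear p -> (forall x, p x <= L * `|x|) ->
  dense [set x | forall v (eta : R), 0 < eta -> symmetric_slope_lt p v eta x].
Proof.
move=> /separable_sequence[e ed] L0 sp pL.
(* Baire's theorem takes a sequence of sets, so the pairs (direction, precision) are coded by
   naturals; a number coding no pair gets the whole space. *)
pose G (i : nat) : set X :=
  if (unpickle i : option (nat * nat)) is Some (n, m)
  then symmetric_slope_lt p (e n) m.+1%:R^-1 else setT.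
have /Baire Gd : forall i, open (G i) /\ dense (G i).
  move=> i; rewrite /G; case: unpickle => [[n m]|].
    split; first exact: open_symmetric_slope_lt pL.
    by apply: dense_symmetric_slope_lt pL _ => //; rewrite invr_gt0.
  split; first exact: openT.
  by move=> O O0 _; rewrite setIT.
move=> O O0 Oo; have [x [Ox Gx]] := Gd O O0 Oo; exists x; split=> // v eta eta0.
have L1 : 0 < 4 * L + 1 by lra.
(* Half of [eta] pays for replacing [v] by [e n], the other half for the slope along [e n]. *)
have [|n vn] := ed v (eta / 2 / (4 * L + 1)); first by rewrite !divr_gt0.
have [m meta] : exists m, m.+1%:R^-1 < eta / 2.
  exists (Num.trunc (2 / eta)).
  rewrite -[eta / 2]invrK ltf_pV2 ?posrE ?invr_gt0 ?divr_gt0// invf_div.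
  exact: truncnS_gt.
have := Gx (pickle (n, m)) I; rewrite /G pickleK => -[t t0 xt]; exists t => //.
move: (m.+1%:R^-1) meta xt => c meta xt.
have := sublinear_lip (x + t *: v) (x + t *: e n) sp pL.
have := sublinear_lip (x - t *: v) (x - t *: e n) sp pL.
have -> : x + t *: v - (x + t *: e n) = t *: (v - e n).
  by rewrite opprD addrACA subrr add0r scalerBr.
have -> : x - t *: v - (x - t *: e n) = - (t *: (v - e n)).
  by rewrite opprD addrACA subrr add0r scalerBr opprD.
rewrite normrN normrZ (gtr0_norm t0).
move: vn; rewrite ltr_pdivlMr// => vn.
have : t * c < t * (eta / 2) by rewrite ltr_pM2l.
have : t * (`|v - e n| * (4 * L + 1)) < t * (eta / 2) by rewrite ltr_pM2l.
have tv0 := mulr_ge0 (ltW t0) (normr_ge0 (v - e n)).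
have := mulr_ge0 L0 tv0; lra.
Qed.

(** * Gauges and weak limits *)

Definition gauge_at (R : realType) (V : lmodType R) (G : set V) (x : V) : set R :=
  [set t | 0 < t /\ G (t^-1 *: x)].

Definition gauge (R : realType) (V : lmodType R) (G : set V) (x : V) : R :=
  inf (gauge_at G x).

Lemma gauge_le (R : realType) (V : lmodType R) (G : set V) (x : V) (t : R) :
  0 < t -> G (t^-1 *: x) -> gauge G x <= t.
Proof.
by move=> t0 Gx; apply: ge_inf; [exists 0 => s [/ltW]|split].
Qed.

Lemma gauge_at_ball (R : realType) (X : normedModType R) (G : set X) (r : R)
    (x : X) (t : R) :
  0 < t -> (forall y, `|y| <= r -> G y) -> `|x| <= r * t -> gauge_at G x t.
Proof.
move=> t0 Gr xr; split=> //; apply: Gr.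
by rewrite normrZ gtr0_norm ?invr_gt0// mulrC ler_pdivrMr.
Qed.

Lemma gauge_at_nonempty (R : realType) (X : normedModType R) (G : set X) (r : R)
    (x : X) :
  0 < r -> (forall y, `|y| <= r -> G y) -> gauge_at G x !=set0.
Proof.
move=> r0 Gr; exists (`|x| / r + 1).
have x0 : 0 <= `|x| / r by rewrite divr_ge0// ltW.
apply: (gauge_at_ball _ Gr); first lra.
by rewrite mulrDr mulrCA divff ?gt_eqF//; lra.
Qed.

Lemma gauge_le_norm (R : realType) (X : normedModType R) (G : set X) (r : R)
    (x : X) :
  0 < r -> (forall y, `|y| <= r -> G y) -> gauge G x <= r^-1 * `|x|.
Proof.
move=> r0 Gr; apply/ler_addgt0Pr => e e0.
have x0 : 0 <= r^-1 * `|x| by rewrite mulr_ge0// invr_ge0 ltW.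
have t0 : 0 < r^-1 * `|x| + e by lra.
have [] := gauge_at_ball (x := x) t0 Gr; last by move=> *; exact: gauge_le.
by rewrite mulrDr mulVKf ?gt_eqF// lerDl mulr_ge0// ltW.
Qed.

Lemma gauge_sublinear (R : realType) (X : normedModType R) (G : set X) (r : R) :
  0 < r -> (forall y, `|y| <= r -> G y) -> convex_subset G ->
  sublinear (gauge G).
Proof.
move=> r0 Gr Gc; have G0 x := gauge_at_nonempty x r0 Gr; split=> [x y|a x a0].
  apply: inf_le_infD => // s t [s0 Gx] [t0 Gy].
  have st0 : 0 < s + t by lra.
  apply: gauge_le => //.
  have := Gc _ _ (s / (s + t)) Gx Gy; rewrite !scalerA.
  have -> : s / (s + t) * s^-1 = (s + t)^-1 by field; lra.
  have -> : (1 - s / (s + t)) * t^-1 = (s + t)^-1 by field; lra.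
  rewrite -scalerDr; apply; first by rewrite divr_ge0 ?ltW.
  by rewrite ler_pdivrMr//; lra.
rewrite -ler_pdivrMl//; apply: lb_le_inf => // t [t0 Gx].
rewrite ler_pdivrMl//; apply: gauge_le; first by rewrite mulr_gt0.
by rewrite scalerA invfM mulrAC mulVf ?gt_eqF// mul1r.
Qed.

Lemma gauge_le1 (R : realType) (V : lmodType R) (G : set V) (x : V) :
  G x -> gauge G x <= 1.
Proof. by move=> Gx; apply: gauge_le => //; rewrite invr1 scale1r. Qed.

Lemma gauge_lt1 (R : realType) (X : normedModType R) (G : set X) (r : R) (x : X) :
  0 < r -> (forall y, `|y| <= r -> G y) -> convex_subset G ->
  gauge G x < 1 -> G x.
Proof.
move=> r0 Gr Gc x1; have G0 : G 0 by apply: Gr; rewrite normr0 ltW.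
have [||t [t0 Gt]] := @inf_adherent _ (gauge_at G x) (1 - gauge G x).
- by rewrite subr_gt0.
- split; first exact: gauge_at_nonempty r0 Gr.
  by exists 0 => s [/ltW].
rewrite -/(gauge G x) subrKC => t1.
have := Gc _ _ t Gt G0 (ltW t0) (ltW t1).
by rewrite scalerA divff ?gt_eqF// scale1r scaler0 addr0.
Qed.

(** The points [(1 - d) *: x] have gauge below 1, so they lie in [G], and they come arbitrarily
    close to [x]. *)
Lemma gauge_closed (R : realType) (X : normedModType R) (G : set X) (r : R) (x : X) :
  0 < r -> (forall y, `|y| <= r -> G y) -> convex_subset G -> closed G ->
  gauge G x <= 1 -> G x.
Proof.
move=> r0 Gr Gc; rewrite -openC => /open_normP Go x1; apply: contrapT => /Go[e e0 xG].
have x0 := normr_ge0 x; have e1 : 0 < e + `|x| + 1 by lra.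
pose d := e / (e + `|x| + 1).
have d0 : 0 < d by rewrite divr_gt0.
have d1 : d < 1 by rewrite ltr_pdivrMr//; lra.
apply: (xG ((1 - d) *: x)).
  rewrite scalerBl scale1r opprB addrC subrK normrZ gtr0_norm//.
  by rewrite mulrAC ltr_pdivrMr//; nra.
apply: (gauge_lt1 r0 Gr Gc).
by rewrite (sublinearZ _ (gauge_sublinear r0 Gr Gc)); [nra|lra].
Qed.

Lemma dual_elem_bound (R : realType) (X : normedModType R) (f : X -> R) :
  dual_elem f -> exists2 C : R, 0 <= C & forall x, `|f x| <= C * `|x|.
Proof.
move=> [/continuousP fc fl].
have f0 : f 0 = 0 by have := fl 1 0 0; rewrite scale1r addr0; lra.
have fZ (a : R) x : f (a *: x) = a * f x by rewrite -[a *: x]addr0 fl f0 addr0.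
have /fc/open_normP/(_ 0)[|e e0 fe] : open (ball (0 : R) 1) by exact: ball_open.
  by rewrite /= f0; exact: ballxx.
exists (2 / e) => [|x]; first by rewrite divr_ge0// ltW.
have [->|x0] := eqVneq x 0; first by rewrite f0 !normr0 mulr0.
have nx : 0 < `|x| by rewrite normr_gt0.
have a0 : 0 < e / 2 / `|x| by rewrite !divr_gt0.
have := fe ((e / 2 / `|x|) *: x).
rewrite sub0r normrN normrZ gtr0_norm// divfK ?gt_eqF// -ball_normE /=.
rewrite sub0r normrN fZ normrM gtr0_norm// => h.
have /h/ltW : e / 2 < e by lra.
move=> hx; rewrite -(ler_pM2l a0).
by have -> : e / 2 / `|x| * (2 / e * `|x|) = 1 by field; rewrite !gt_eqF.
Qed.

(** Compactness of the segment gives a cluster point, and a cluster point of an ultrafilter is a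
    limit. *)
Lemma ultrafilter_cvg (R : realType) (U : set_system nat) (a : nat -> R) (M : R) :
  UltraFilter U -> (forall n, `|a n| <= M) -> cvg (a n @[n --> U]).
Proof.
move=> UU aM.
have [l [_ lU]] : `[- M, M]%classic `&` cluster (a n @[n --> U]) !=set0.
  apply: segment_compact; apply: nearW => n.
  by rewrite /= in_itv /= -ler_norml.
apply/cvg_ex; exists l => A lA.
have [//|UA] := in_ultra_setVsetC (a @^-1` A) UU.
by have [x []] := lU (~` A) A UA lA.
Qed.

(* Reflexivity applied to the limit along a free ultrafilter replaces weak
   sequential compactness of bounded sets. *)
Lemma reflexive_weak_limit (R : realType) (X : normedModType R) (d : nat -> X) (M : R) :
  reflexive_space X -> (forall n, `|d n| <= M) ->
  exists U : set_system nat, exists x : X, [/\ ProperFilter U, \oo `<=` U &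
    forall f, dual_elem f -> f (d n) @[n --> U] --> f x].
Proof.
move=> refl dM; have [U [UU ooU]] := @ultraFilterLemma nat \oo _.
have fU f : dual_elem f -> cvg (f (d n) @[n --> U]).
  move=> /dual_elem_bound[C C0 fC]; apply: (ultrafilter_cvg (M := C * M)) => n.
  by apply: le_trans (fC _) _; rewrite ler_wpM2l.
(* The limit along [U] is linear in [f] and bounded with constant [M], hence an element of the
   bidual, represented by some [x]. *)
have [|x xU] := refl (fun f => lim (f (d n) @[n --> U])).
  split; first by move=> f g /fU cf /fU cg; exact: limD.
  split.
    move=> a f /fU cf; apply: cvg_lim => //; exact: cvgMr.
  exists M => f C df C0 fC; rewrite mulrC ler_norml; apply/andP; split.
    apply: limr_ge; first exact: fU.
    apply: nearW => n; have := fC (d n); rewrite ler_norml => /andP[+ _].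
    by apply: le_trans; rewrite lerN2 ler_wpM2l.
  apply: limr_le; first exact: fU.
  apply: nearW => n; have := fC (d n); rewrite ler_norml => /andP[_].
  by move=> h; apply: le_trans h _; rewrite ler_wpM2l.
exists U, x; split=> [|A|f df].
- exact: ultra_proper.
- exact: ooU.
- by have /= <- := xU f df; exact: fU.
Qed.

(** * Contractive half-spaces *)

Lemma norm_sublinear (R : realType) (X : normedModType R) :
  sublinear (fun x : X => `|x|).
Proof.
split=> [x y|a x a0]; first exact: ler_normD.
by rewrite normrZ gtr0_norm.
Qed.

(** Weak lower semicontinuity of the norm, tested on a functional of norm at most one that attains
    the norm at [x - c]. *)
Lemma weak_limit_norm_le (R : realType) (X : normedModType R) (U : set_system nat)
    (d : nat -> X) (x c : X) (M : R) :
  ProperFilter U ->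
  (forall f, dual_elem f -> f (d n) @[n --> U] --> f x) ->
  (\forall n \near U, `|d n - c| <= M) -> `|x - c| <= M.
Proof.
move=> UU dx dM; have [g [gl gle gx]] := hahn_banach (x - c) (norm_sublinear X).
have dg : dual_elem g.
  by apply: (dual_elem_bounded ler01 gl) => y; rewrite mul1r; exact: gle.
have cg : g (d n) @[n --> U] --> g x by exact: dx.
rewrite -gx linear_sub// lerBlDr -(cvg_lim _ cg)//.
apply: limr_le; first by apply/cvg_ex; exists (g x).
near=> n; rewrite -lerBlDr -linear_sub//; apply: le_trans (gle _) _.
by near: n.
Unshelve. all: by end_near. Qed.

(* Convexity of the norm moves an admissible image of [v0] along the segment
   towards [v0] until it meets the kernel of [f]. *)
Lemma exists_kernel_projection (R : realType) (X : normedModType R) (f : X -> R)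
    (v0 x : X) :
  (forall (a : R) x y, f (a *: x + y) = a * f x + f y) -> f v0 = 1 -> f x <= 0 ->
  (forall c, f c <= 0 -> `|x - c| <= `|v0 - c|) ->
  exists2 w, f w = 1 & forall u, f u = 0 -> `|u| <= `|u + w|.
Proof.
move=> fl fv0 fx xc; pose a := 1 - f x; pose y := v0 - x.
have f0 : f 0 = 0 by have := fl 1 0 0; rewrite scale1r addr0; lra.
have fZ (b : R) z : f (b *: z) = b * f z by rewrite -[b *: z]addr0 fl f0 addr0.
have fD z z' : f (z + z') = f z + f z' by rewrite -[z]scale1r fl mul1r scale1r.
have a1 : 1 <= a by rewrite /a; lra.
have a0 : 0 < a by lra.
have fy : f y = a by rewrite /y linear_sub// fv0.
exists (a^-1 *: y); first by rewrite fZ fy mulVf ?gt_eqF.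
(* [x + l *: y] is where the segment from [x] to [v0] meets the kernel of [f]. The hypothesis is
   applied to this point minus [u]. *)
move=> u fu; pose l := 1 - a^-1.
have l0 : 0 <= l by rewrite subr_ge0 invf_le1.
have l1 : l <= 1 by rewrite /l lerBlDr lerDl invr_ge0 ltW.
have /xc : f (x + l *: y - u) <= 0.
  by rewrite linear_sub// fD fZ fy fu subr0 /l mulrBl mulVf ?gt_eqF// /a; lra.
have -> : x - (x + l *: y - u) = u - l *: y.
  by rewrite !opprD opprK addrA addrA subrr add0r addrC.
have -> : v0 - (x + l *: y - u) = u + a^-1 *: y.
  rewrite !opprD opprK addrA addrA -/y addrC; congr (_ + _).
  by rewrite -{1}[y]scale1r -scalerBl /l opprB addrC subrK.
set p := `|u + a^-1 *: y| => h.
(* With [z = y] this writes [u] as a convex combination of two vectors of norm at most [p]. *)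
have comb (z : X) : u = l *: (u + (1 - l) *: z) + (1 - l) *: (u - l *: z).
  rewrite !scalerDr scalerN !scalerA addrACA -scalerDl subrKC scale1r.
  by rewrite [(1 - l) * l]mulrC subrr addr0.
rewrite [X in `|X| <= _](comb y) (_ : 1 - l = a^-1); last first.
  by rewrite /l opprB addrC subrK.
apply: le_trans (ler_normD _ _) _.
rewrite !normrZ !ger0_norm ?invr_ge0 ?(ltW a0)// -/p.
have ai : 0 <= a^-1 by rewrite invr_ge0 ltW.
have := ler_wpM2l ai h; rewrite -/p /l; lra.
Qed.

(** At [s = f v] this is the norm-one projection onto the kernel along [w], by scaling the
    hypothesis on [w]; smaller [s] give convex combinations of [v] and its projection. *)
Lemma norm_sub_scale_le (R : realType) (X : normedModType R) (f : X -> R)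
    (w v : X) (s : R) :
  (forall (a : R) x y, f (a *: x + y) = a * f x + f y) -> f w = 1 ->
  (forall u, f u = 0 -> `|u| <= `|u + w|) -> 0 <= s -> s <= f v ->
  `|v - s *: w| <= `|v|.
Proof.
move=> fl fw uw s0 sv.
have [v0|v0] := eqVneq (f v) 0.
  have -> : s = 0 by lra.
  by rewrite scale0r subr0.
have fv : 0 < f v by rewrite lt_def v0/=; lra.
have f0 : f 0 = 0 by have := fl 1 0 0; rewrite scale1r addr0; lra.
have fZ (b : R) z : f (b *: z) = b * f z by rewrite -[b *: z]addr0 fl f0 addr0.
have qv : `|v - f v *: w| <= `|v|.
  have := uw ((f v)^-1 *: (v - f v *: w)).
  rewrite fZ linear_sub// fZ fw mulr1 subrr mulr0 => /(_ erefl).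
  have -> : (f v)^-1 *: (v - f v *: w) + w = (f v)^-1 *: v.
    by rewrite scalerBr scalerA mulVf// scale1r subrK.
  by rewrite !normrZ ler_pM2l// normr_gt0 invr_eq0.
have [b [b0 b1 bfv]] : exists b : R, [/\ 0 <= b, b <= 1 & b * f v = s].
  exists (s / f v); split; [|by rewrite ler_pdivrMr// mul1r|by rewrite divfK].
  by rewrite divr_ge0// ltW.
have -> : v - s *: w = (1 - b) *: v + b *: (v - f v *: w).
  by rewrite scalerBl scale1r scalerBr scalerA bfv addrA subrK.
apply: le_trans (ler_normD _ _) _.
rewrite !normrZ (ger0_norm b0) ger0_norm ?subr_ge0//.
by have := ler_wpM2l b0 qv; lra.
Qed.

Lemma contractive_half_space_of_kernel_projection (R : realType) (X : normedModType R)
    (f : X -> R) (w : X) (d : R) :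
  dual_elem f -> f w = 1 -> (forall u, f u = 0 -> `|u| <= `|u + w|) ->
  contractive_half_space [set x | f x <= d].
Proof.
move=> df fw uw; have fl := df.2.
have f0 : f 0 = 0 by have := fl 1 0 0; rewrite scale1r addr0; lra.
have fZ (b : R) z : f (b *: z) = b * f z by rewrite -[b *: z]addr0 fl f0 addr0.
split; first by exists f, d; split=> //; split=> //; exists w; rewrite fw oner_eq0.
pose m x := Num.max (f x - d) 0; pose P x := x - m x *: w.
have Pd x : f (P x) <= d.
  by rewrite linear_sub// fZ fw mulr1 /m; have [] := leP (f x - d) 0; lra.
split; first by exists (P 0); exact: Pd.
exists P; split; first exact: Pd.
split=> [x /= xd|].
  by rewrite /P /m max_r ?scale0r ?subr0// subr_le0.
(* [m] is a nondecreasing 1-Lipschitz function of [f], so [m x - m y] lies between 0 and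
   [f (x - y)]. *)
have Ple x y : f y <= f x -> `|P x - P y| <= `|x - y|.
  move=> yx.
  have -> : P x - P y = (x - y) - (m x - m y) *: w.
    by rewrite /P opprB addrACA scalerBl opprB [- _ + _]addrC addrACA.
  apply: (norm_sub_scale_le fl fw uw); rewrite ?linear_sub// /m.
    by have [] := leP (f x - d) 0; have [] := leP (f y - d) 0; lra.
  by have [] := leP (f x - d) 0; have [] := leP (f y - d) 0; lra.
move=> x y; have [/Ple//|/ltW/Ple] := leP (f y) (f x).
by rewrite distrC [`|y - x|]distrC.
Qed.

(** * Half-spaces supporting an existence set *)

(** The minorant [f] touches [p] at [s], so [p (s - t v) >= p s - t * f v]; a symmetric slope below
    [- f v] then forces [p (s + t v) < p s]. *)
Lemma smooth_descent (R : realType) (X : lmodType R) (p f : X -> R) (s v : X) :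
  (forall (eta : R), 0 < eta -> symmetric_slope_lt p v eta s) ->
  (forall (a : R) x y, f (a *: x + y) = a * f x + f y) ->
  (forall x, f x <= p x) -> f s = p s -> f v < 0 ->
  exists2 t : R, 0 < t & p (s + t *: v) < p s.
Proof.
move=> sm fl fp fs fv; have [|t t0 st] := sm (- f v); first by rewrite oppr_gt0.
exists t => //; have := fp (s - t *: v).
by rewrite addrC -scaleNr fl fs scaleNr [- _ + s]addrC; lra.
Qed.

Lemma convex_towards (R : realType) (X : lmodType R) (G : set X) (c v : X) (t t' : R) :
  (forall x y (a : R), G x -> G y -> 0 <= a -> a <= 1 -> G (a *: x + (1 - a) *: y)) ->
  G c -> 0 < t -> G (c + t *: v) -> 0 <= t' -> t' <= t -> G (c + t' *: v).
Proof.
move=> Gc Gx t0 Gt t'0 t't.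
have := Gc _ _ (t' / t) Gt Gx; rewrite scalerDr scalerA divfK ?gt_eqF//.
rewrite addrAC -scalerDl subrKC scale1r; apply; first by rewrite divr_ge0// ltW.
by rewrite ler_pdivrMr// mul1r.
Qed.

Lemma smooth_support_contractive (R : realType) (X : normedModType R) (F : set X)
    (x0 s : X) (r : R) (f : X -> R) (d : R) :
  let G := [set v | F (x0 + v)] in
  reflexive_space X -> existence_set F -> convex_subset G -> closed G ->
  0 < r -> (forall y, `|y| <= r -> G y) ->
  (forall v (eta : R), 0 < eta -> symmetric_slope_lt (gauge G) v eta s) ->
  0 < gauge G s -> dual_elem f -> (forall x, f x <= gauge G x) ->
  f s = gauge G s ->
  contractive_half_space [set x | f x <= d].
Proof.
move=> G refl [_ exF] Gc Gcl r0 Gr sm ps0 df fp fs; have fl := df.2.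
have sp := gauge_sublinear r0 Gr Gc.
have f0 : f 0 = 0 by have := fl 1 0 0; rewrite scale1r addr0; lra.
have fZ (b : R) z : f (b *: z) = b * f z by rewrite -[b *: z]addr0 fl f0 addr0.
pose c0 := (gauge G s)^-1 *: s.
have fc0 : f c0 = 1 by rewrite fZ fs mulVf ?gt_eqF.
have pc0 : gauge G c0 = 1.
  by rewrite /c0 (sublinearZ _ sp) ?mulVf ?gt_eqF// invr_ge0 ltW.
have Gc0 : G c0 by apply: (gauge_closed r0 Gr Gc Gcl); rewrite pc0.
have near_c0 v : f v < 0 -> exists2 t : R, 0 < t & G (c0 + t *: v).
  move=> fv; have [t t0 st] := smooth_descent (sm v) fl fp fs fv.
  exists (t / gauge G s); first by rewrite divr_gt0.
  apply: (gauge_lt1 r0 Gr Gc).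
  have -> : c0 + (t / gauge G s) *: v = (gauge G s)^-1 *: (s + t *: v).
    by rewrite scalerDr scalerA mulrC.
  rewrite (sublinearZ _ sp) ?invr_ge0 ?(ltW ps0)//.
  by rewrite ltr_pdivrMl// mulr1.
have nz (n : nat) : n.+1%:R != 0 :> R by rewrite pnatr_eq0.
(* The existence property is used at points just beyond the boundary point [x0 + c0], at distance of
   order [1 / (n + 1)]. *)
have /choice[e eP] : forall n : nat, exists e,
    RF F (x0 + c0 + n.+1%:R^-1 *: c0) e.
  by move=> n; exact: exF.
pose dn n := n.+1%:R *: (e n - x0 - c0).
(* This is the inequality defining [RF], magnified by [n + 1] about [x0 + c0]. *)
have dnc n c : G (c0 + n.+1%:R^-1 *: c) -> `|dn n - c| <= `|c0 - c|.
  move=> /(proj2 (eP n)).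
  have -> : x0 + c0 + n.+1%:R^-1 *: c0 - (x0 + (c0 + n.+1%:R^-1 *: c)) =
      n.+1%:R^-1 *: (c0 - c) by rewrite addrA opprD addrACA subrr add0r scalerBr.
  rewrite normrZ gtr0_norm ?invr_gt0// -ler_pdivrMl ?invr_gt0// invrK.
  rewrite -{1}[n.+1%:R]gtr0_norm// -normrZ; apply: le_trans.
  rewrite [X in _ <= `|_ *: X|](_ : _ = (e n - x0 - c0) - n.+1%:R^-1 *: c).
    by rewrite [X in _ <= `|X|]scalerBr scalerA divff// scale1r.
  by rewrite !opprD !addrA.
have fdn n : f (dn n) <= 0.
  have := fp (e n - x0); have : gauge G (e n - x0) <= 1.
    by apply: gauge_le1; rewrite /G /= subrKC; exact: (eP n).1.
  move=> h1 h2; rewrite /dn fZ (linear_sub _ _ fl) fc0.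
  by rewrite pmulr_rle0//; lra.
have dnb n : `|dn n| <= `|c0|.
  by have := dnc n 0; rewrite scaler0 addr0 !subr0; exact.
have [U [x [UU ooU Ux]]] := reflexive_weak_limit refl dnb.
have fx : f x <= 0.
  rewrite -(cvg_lim _ (Ux f df))//; apply: limr_le.
    by apply/cvg_ex; exists (f x); exact: Ux.
  exact: nearW.
(* Smoothness puts [c0 + t *: c] in [G] for one [t > 0] and convexity for all smaller ones, so [dnc]
   applies for all large [n] and survives the weak limit. *)
have xlt c : f c < 0 -> `|x - c| <= `|c0 - c|.
  move=> fc; apply: (weak_limit_norm_le UU Ux).
  have [t t0 Gt] := near_c0 c fc.
  apply: ooU; exists (Num.trunc t^-1) => // n /= tn; apply: dnc.
  apply: (convex_towards Gc Gc0 t0 Gt) => //.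
  rewrite -[t]invrK lef_pV2 ?posrE ?invr_gt0//; apply/ltW.
  by apply: lt_le_trans (truncnS_gt _) _; rewrite ler_nat.
(* Moving [c] by [- k *: c0] makes [f] negative and costs at most [2 * k * |c0|] in the two norms
   together. *)
have xle c : f c <= 0 -> `|x - c| <= `|c0 - c|.
  move=> fc; apply/ler_addgt0Pr => eps eps0.
  have k1 : 0 < 2 * `|c0| + 1 by have := normr_ge0 c0; lra.
  pose k := eps / (2 * `|c0| + 1).
  have k0 : 0 < k by rewrite divr_gt0.
  have kb : 2 * k * `|c0| <= eps.
    by rewrite mulrAC /k mulrA ler_pdivrMr//; nra.
  have /xlt : f (c - k *: c0) < 0.
    by rewrite (linear_sub _ _ fl) fZ fc0 mulr1; lra.
  have := ler_normD (x - (c - k *: c0)) (- (k *: c0)).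
  have := ler_normD (c0 - c) (k *: c0).
  rewrite normrN normrZ gtr0_norm// !opprD opprK !addrA addrK; lra.
have [w fw uw] := exists_kernel_projection fl fc0 fx xle.
exact: contractive_half_space_of_kernel_projection fw uw.
Qed.

Theorem theorem16 (R : realType) (X : completeNormedModType R) (F : set X) :
  reflexive_space X -> separable_space X ->
  F !=set0 -> closed F -> bounded_subset F -> convex_subset F ->
  existence_set F -> interior F !=set0 ->
  exists Hs : set (set X),
    countable Hs /\ (forall H, Hs H -> contractive_half_space H) /\
    F = \bigcap_(H in Hs) H.
Proof.
move=> refl sepX _ Fcl _ Fc exF [x0 /nbhs_ballP[r' r'0]].
rewrite -ball_normE => Fr'; pose G := [set v | F (x0 + v)].
have [r r0 Gr] : exists2 r : R, 0 < r & forall y, `|y| <= r -> G y.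
  exists (r' / 2); first by rewrite divr_gt0.
  move=> y yr; apply: Fr'; rewrite /= opprD addNKr normrN.
  by apply: le_lt_trans yr _; move: r'0; rewrite /=; lra.
have Gc : convex_subset G.
  move=> x y t Gx Gy t0 t1; have := Fc _ _ t Gx Gy t0 t1.
  by rewrite !scalerDr addrACA -scalerDl subrKC scale1r.
have Gcl : closed G.
  rewrite -openC; apply/open_normP => x.
  move: Fcl; rewrite -openC => /open_normP h /h[e e0 xe]; exists e => // y xy.
  by apply: xe; rewrite opprD addrACA subrr add0r.
set p := gauge G; have sp : sublinear p := gauge_sublinear r0 Gr Gc.
have L0 : 0 <= r^-1 by rewrite invr_ge0 ltW.
have pL x : p x <= r^-1 * `|x| := gauge_le_norm x r0 Gr.
have [q qd] := separable_sequence sepX.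
(* Near each [q n], at every scale, choose a smooth point of the gauge together with a subgradient
   there. *)
have /choice[sf sfP] : forall i : nat * nat, exists sf : X * (X -> R),
    [/\ `|q i.1 - sf.1| < i.2.+1%:R^-1,
     forall v (eta : R), 0 < eta -> symmetric_slope_lt p v eta sf.1,
     dual_elem sf.2, forall x, sf.2 x <= p x & sf.2 sf.1 = p sf.1].
  move=> [n m] /=.
  have [||s [qs ss]] := dense_smooth_points sepX L0 sp pL (O := ball (q n) m.+1%:R^-1).
  - by exists (q n); apply: ballxx; rewrite invr_gt0.
  - exact: ball_open.
  have [f [fl fp fs]] := hahn_banach s sp.
  exists (s, f); split=> //=; first by move: qs; rewrite -ball_normE.
  by apply: dual_elem_bounded L0 fl _ => x; exact: le_trans (fp x) (pL x).
(* These are the half-spaces [f (x - x0) <= 1]; positive gauge lets the smooth point be rescaled to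
   the boundary. *)
exists [set [set x | (sf i).2 x <= 1 + (sf i).2 x0] |
  i in [set i | 0 < p (sf i).1]].
split; first by exact: sub_countable (card_image_le _ _) (countableP _).
split=> [_ [i i0 <-]|].
  have [_ ss df fp fs] := sfP i.
  exact: smooth_support_contractive refl exF Gc Gcl r0 Gr ss i0 df fp fs.
apply/seteqP; split=> [x Fx _ [i i0 <-] /=|x xH].
  have [_ _ df fp _] := sfP i.
  rewrite -lerBlDr -(linear_sub _ _ df.2); apply: le_trans (fp _) _.
  by apply: gauge_le1; rewrite /G /= subrKC.
apply: contrapT => nFx; set y := x - x0.
have py : 1 < p y.
  rewrite ltNge; apply/negP => /(gauge_closed r0 Gr Gc Gcl).
  by rewrite /G /y /= subrKC.
(* A smooth point [s] is found within [2 * k] of [y]. Passing from [p y] to [p s = f s] and then to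
   [f y] costs at most [2 * k / r] each time, so [f y >= p y - 4 * k / r > 1]. *)
have k1 : 0 < 4 * r^-1 + 1 by lra.
pose k := (p y - 1) / (4 * r^-1 + 1).
have k0 : 0 < k by rewrite divr_gt0// subr_gt0.
have kE : k * (4 * r^-1 + 1) = p y - 1 by rewrite divfK ?gt_eqF.
have [n yn] := qd y k k0.
have mk : (Num.trunc k^-1).+1%:R^-1 < k.
  by rewrite -[ltRHS]invrK ltf_pV2 ?posrE ?invr_gt0//; exact: truncnS_gt.
pose i := (n, Num.trunc k^-1); have [qs _ df fp fs] := sfP i.
have {}qs : `|q n - (sf i).1| < k := lt_trans qs mk.
have ys : `|y - (sf i).1| <= 2 * k.
  rewrite -(subrKA (q n)); apply: le_trans (ler_normD _ _) _.
  by move: yn qs; lra.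
have h1 := sublinear_lip y (sf i).1 sp pL.
have h2 : r^-1 * `|y - (sf i).1| <= r^-1 * (2 * k) by rewrite ler_wpM2l.
have h3 : r^-1 * (2 * k) * 2 < p y - 1 by rewrite -kE; nra.
have h4 : 0 <= r^-1 * (2 * k) by rewrite mulr_ge0//; lra.
have s0 : 0 < p (sf i).1 by lra.
have /= := xH _ (ex_intro2 _ _ i s0 erefl).
rewrite -lerBlDr -(linear_sub _ _ df.2) -/y.
have := fp ((sf i).1 - y); rewrite (linear_sub _ _ df.2) fs.
have := pL ((sf i).1 - y); rewrite distrC.
lra.
Qed.
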